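(* Let $\varphi$ be a complete Bernstein function of the form $\varphi(x)=\int_0^\infty(1-e^{-sx})\overline\nu(s)\,ds$, with $\overline\nu$ a completely monotone Lévy density, satisfying $\lim_{\theta\to0}\varphi(\theta)=0$ and $\lim_{\theta\to\infty}\varphi(\theta)=+\infty$, and let $\nu(x)=\int_x^\infty\overline\nu(z)dz$, $x>0$. If $\overline\nu\in L^2(1,\infty)$ and $\nu\in L^2(0,1)\cap L^p(1,\infty)$ for some $p\ge1$, then the process $$B_t^\nu=\sqrt{C_\nu}\int_{\mathbb R}\big[\nu((t-u)_+)-\nu((-u)_+)\big]dW_u,\qquad t\ge0,$$ displays short-range dependence, i.e. $\sum_{n=1}^\infty|\rho_n|<\infty$, where $\rho_n:=\mathbb E\big[B_1^\nu(B_{n+1}^\nu-B_n^\nu)\big]$.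
   Context: A Lévy density satisfies $\int_0^\infty(s\wedge1)\overline\nu(s)ds<\infty$. $\nu$ is extended by $\nu(x)=0$ for $x\le0$, and $(x)_+=\max(x,0)$. $W=(W_u)_{u\in\mathbb R}$ is a two-sided Wiener process, and $C_\nu=\big(\int_{\mathbb R}[\nu((1-u)_+)-\nu((-u)_+)]^2du\big)^{-1}$ is a normalising constant. Under the stated hypotheses the integrand is in $L^2(\mathbb R)$ for every $t\ge0$. *)

(* Defs.v *)
From HB Require Import structures.
From mathcomp Require Import all_boot all_order all_algebra.
From mathcomp Require Import all_classical all_reals all_analysis.

Set Implicit Arguments.
Unset Strict Implicit.
Unset Printing Implicit Defensive.

Import Order.TTheory GRing.Theory Num.Def Num.Theory.
Import numFieldNormedType.Exports.

Local Open Scope classical_set_scope.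
Local Open Scope ring_scope.

Section bernstein.
Context {R : realType}.
Local Notation mu := (@lebesgue_measure R).
Implicit Types (m phi f : R -> R) (D : set R) (p : R).

(* Only the restriction to (0, +oo) matters: derive1n n f at x > 0 depends only on
   values of f near x. *)
Definition completely_monotone f : Prop :=
  forall (n : nat) (x : R), 0 < x ->
    derivable (derive1n n f) x 1 /\ 0 <= (-1) ^+ n * derive1n n f x.

Definition levy_density m : Prop :=
  [/\ measurable_fun (`]0%R, +oo[ : set R) m,
      forall s, 0 < s -> 0 <= m s &
      (\int[mu]_(s in `]0%R, +oo[) (Num.min s 1 * m s)%:E < +oo)%E].

Definition laplace_exponent m (x : R) : \bar R :=
  (\int[mu]_(s in `]0%R, +oo[) ((1 - expR (- (s * x))) * m s)%:E)%E.

Definition complete_bernstein phi : Prop :=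
  exists (a b : R) (m : R -> R),
    [/\ 0 <= a, 0 <= b, levy_density m, completely_monotone m &
        forall x, 0 < x ->
          (phi x)%:E = ((a + b * x)%:E + laplace_exponent m x)%E].

(* f \_ D vanishes outside D, as point = 0 in R. *)
Definition in_Lp p D f : Prop :=
  (f \_ D : R -> R) \in Lfun mu p%:E.

Definition levy_tail m (x : R) : R :=
  if 0 < x then \int[mu]_(z in `]x, +oo[) m z else 0.

Definition B_kernel (nu : R -> R) (t u : R) : R :=
  nu (Num.max (t - u) 0) - nu (Num.max (- u) 0).

Definition B_const (nu : R -> R) : R :=
  (\int[mu]_u (B_kernel nu 1 u) ^+ 2)^-1.

End bernstein.

Section wiener.
Context {d : measure_display} {T : measurableType d} {R : realType}.
Variable P : probability T R.
Local Notation mu := (@lebesgue_measure R).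

(* Taking some of the sets A i to be setT gives the product rule for every
   subfamily. *)
Definition mutually_independent (n : nat) (X : 'I_n -> T -> R) : Prop :=
  forall A : 'I_n -> set R, (forall i, measurable (A i)) ->
    P (\bigcap_(i in [set: 'I_n]) (X i @^-1` A i)) =
    (\prod_(i < n) P (X i @^-1` A i))%E.

(* normal_prob takes the standard deviation, not the variance. *)
Definition two_sided_wiener (W : R -> {RV P >-> R}) : Prop :=
  [/\ {ae P, forall w, W 0 w = 0},
      forall (n : nat) (t : nat -> R),
        (forall i j : nat, (i <= j)%N -> t i <= t j) ->
        mutually_independent (fun i : 'I_n => W (t i.+1) \- W (t i)),
      forall s t : R, s < t -> forall A : set R, measurable A ->
        P ((W t \- W s) @^-1` A) = normal_prob 0 (Num.sqrt (t - s)) A &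
      {ae P, forall w, continuous (fun t => W t w)}].

(* The entry (c, (a, b)) stands for c times the indicator of ]a, b]. *)
Definition step_data := seq (R * (R * R)).

Definition step_data_wf (s : step_data) : Prop :=
  forall e, e \in s -> e.2.1 <= e.2.2.

Definition step_fun (s : step_data) (u : R) : R :=
  \sum_(e <- s) e.1 * \1_(`]e.2.1, e.2.2] : set R) u.

Definition step_integral (W : R -> {RV P >-> R}) (s : step_data) (w : T) : R :=
  \sum_(e <- s) e.1 * (W e.2.2 w - W e.2.1 w).

(* I is a version of the Wiener integral of f: an L2(P)-limit of the integrals
   of step functions that converge to f in L2(R). *)
Definition is_wiener_integral (W : R -> {RV P >-> R}) (f : R -> R)
    (I : {RV P >-> R}) : Prop :=
  measurable_fun setT f /\
  exists s : nat -> step_data,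
    [/\ forall k, step_data_wf (s k),
        (\int[mu]_u ((f u - step_fun (s k) u) ^+ 2)%:E)%E
          @[k --> \oo] --> 0%E &
        ('E_P[fun w => ((I w - step_integral W (s k) w) ^+ 2)%R])%E
          @[k --> \oo] --> 0%E].

Definition is_B_process (nu : R -> R) (W B : R -> {RV P >-> R}) : Prop :=
  forall t : R, 0 <= t -> exists I : {RV P >-> R},
    is_wiener_integral W (B_kernel nu t) I /\
    {ae P, forall w, B t w = Num.sqrt (B_const nu) * I w}.

Definition rho (B : R -> {RV P >-> R}) (n : nat) : \bar R :=
  ('E_P[fun w => (B 1 w * (B n.+1%:R w - B n%:R w))%R])%E.

Definition short_range_dependent (B : R -> {RV P >-> R}) : Prop :=
  (\sum_(1 <= n <oo) `|rho B n| < +oo)%E.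

End wiener.

(* Main.v *)
Require Import Defs.
From HB Require Import structures.
From mathcomp Require Import all_boot all_order all_algebra.
From mathcomp Require Import all_classical all_reals all_analysis.
From mathcomp Require Import measurable_realfun ring lra.
Import Order.TTheory GRing.Theory Num.Def Num.Theory.
Import numFieldNormedType.Exports.
Set Implicit Arguments.
Unset Strict Implicit.
Unset Printing Implicit Defensive.
Local Open Scope classical_set_scope.
Local Open Scope ring_scope.

(**
The Wiener integral is an isometry, so with [g t := B_kernel nu t] the
correlation [rho n] is, up to a constant, the integral of
[g 1 * (g n.+1 - g n)].  As [nu] is nonnegative and nonincreasing on the positive
half-line, the sum over [n >= 1] of [`|g n.+1 u - g n u|] telescopes and is at most
[nu (1 - u)] when [u < 1], while [g 1 u = 0] when [u >= 1].  It remains to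
integrate [`|g 1 u| * nu (1 - u)] over [u < 1]:
- on [0 <= u < 1] this is [nu (1 - u) ^+ 2], and on [-1 <= u < 0] it is at
  most [nu (- u) ^+ 2]; both are integrable since [nu] is square integrable near 0;
- on [u < -1] it is at most [nu 1 * (nu (- u) - nu (1 - u))], whose integral
  telescopes.
*)

(** * Square-integrable functions and their inner product *)

Section square_integrable.
Context d (T : measurableType d) (R : realType).
Variable m : {measure set T -> \bar R}.
Implicit Types (f g h : T -> R) (a : R).

Definition square_integrable f : Prop :=
  measurable_fun setT f /\ (\int[m]_x ((f x) ^+ 2)%:E < +oo)%E.

Definition inner f g : R := \int[m]_x (f x * g x).

Lemma square_integrable_integrableM f g :
  square_integrable f -> square_integrable g ->
  m.-integrable setT (EFin \o (fun x => f x * g x)).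
Proof.
move=> [mf if2] [mg ig2]; apply/integrableP; split.
  by apply/measurable_EFinP; exact: measurable_funM.
have mf2 : measurable_fun setT (fun x => ((f x) ^+ 2)%:E).
  by apply/measurable_EFinP; exact: measurable_funX.
have mg2 : measurable_fun setT (fun x => ((g x) ^+ 2)%:E).
  by apply/measurable_EFinP; exact: measurable_funX.
apply: (@le_lt_trans _ _
    (\int[m]_x (((f x) ^+ 2)%:E + ((g x) ^+ 2)%:E))%E); last first.
  rewrite ge0_integralD//; first exact: lte_add_pinfty.
  - by move=> x _; rewrite lee_fin sqr_ge0.
  - by move=> x _; rewrite lee_fin sqr_ge0.
apply: ge0_le_integral => //.
- apply: measurableT_comp => //; apply/measurable_EFinP.
  exact: measurable_funM.
- by apply: emeasurable_funD.
- move=> x _ /=; rewrite lee_fin normrM.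
  rewrite -(real_normK (num_real (f x))) -(real_normK (num_real (g x))).
  have := sqr_ge0 (`|f x| - `|g x|); have := sqr_ge0 (`|f x| + `|g x|).
  nra.
Qed.

Lemma square_integrableD f g : square_integrable f -> square_integrable g ->
  square_integrable (f \+ g).
Proof.
move=> hf hg; have [mf if2] := hf; have [mg ig2] := hg.
have mfg : measurable_fun setT (f \+ g) by exact: measurable_funD.
split => //; have mf2 : measurable_fun setT (fun x => ((f x) ^+ 2)%:E).
  by apply/measurable_EFinP; exact: measurable_funX.
have mg2 : measurable_fun setT (fun x => ((g x) ^+ 2)%:E).
  by apply/measurable_EFinP; exact: measurable_funX.
apply: (@le_lt_trans _ _
    (\int[m]_x (2%:E * (((f x) ^+ 2)%:E + ((g x) ^+ 2)%:E)))%E); last first.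
  rewrite ge0_integralZl//; last 2 first.
  - by apply: emeasurable_funD.
  - by move=> x _; rewrite -EFinD lee_fin addr_ge0 ?sqr_ge0.
  rewrite lte_mul_pinfty// ge0_integralD//; first exact: lte_add_pinfty.
  - by move=> x _; rewrite lee_fin sqr_ge0.
  - by move=> x _; rewrite lee_fin sqr_ge0.
apply: ge0_le_integral => //.
- by move=> x _; rewrite lee_fin sqr_ge0.
- by apply/measurable_EFinP; exact: measurable_funX.
- by apply: emeasurable_funM => //; exact: emeasurable_funD.
- move=> x _ /=; rewrite lee_fin; have := sqr_ge0 (f x - g x); nra.
Qed.

Lemma square_integrableZ a f : square_integrable f ->
  square_integrable (fun x => a * f x).
Proof.
move=> [mf if2]; split; first exact: measurable_funM.
under eq_integral do rewrite exprMn EFinM.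
rewrite ge0_integralZl//.
- by rewrite lte_mul_pinfty// lee_fin sqr_ge0.
- by apply/measurable_EFinP; exact: measurable_funX.
- by move=> x _; rewrite lee_fin sqr_ge0.
- by rewrite lee_fin sqr_ge0.
Qed.

Lemma square_integrableB f g : square_integrable f -> square_integrable g ->
  square_integrable (f \- g).
Proof.
move=> hf hg; rewrite (_ : f \- g = f \+ (fun x => -1 * g x)).
  exact/square_integrableD/square_integrableZ.
by apply/funext => x /=; rewrite mulN1r.
Qed.

Lemma square_integrable0 : square_integrable (fun=> 0).
Proof.
split; first exact: measurable_cst.
by under eq_integral do rewrite expr0n/=; rewrite integral0.
Qed.

Lemma innerE f g : square_integrable f -> square_integrable g ->
  (\int[m]_x (f x * g x)%:E)%E = (inner f g)%:E.
Proof.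
move=> hf hg; rewrite /inner /Rintegral fineK//.
by apply: integrable_fin_num => //; exact: square_integrable_integrableM.
Qed.

Lemma innerC f g : inner f g = inner g f.
Proof. by apply: eq_Rintegral => x _; rewrite mulrC. Qed.

Lemma inner_ge0 f : 0 <= inner f f.
Proof. by apply: Rintegral_ge0 => x _; rewrite -expr2 sqr_ge0. Qed.

Lemma inner0l f : inner (fun=> 0) f = 0.
Proof.
by rewrite /inner /Rintegral; under eq_integral do rewrite mul0r;
  rewrite integral0.
Qed.

Lemma innerDl f g h : square_integrable f -> square_integrable g ->
  square_integrable h -> inner (f \+ g) h = inner f h + inner g h.
Proof.
move=> hf hg hh; rewrite -RintegralD//; last 2 first.
  exact: square_integrable_integrableM.
  exact: square_integrable_integrableM.
by apply: eq_Rintegral => x _ /=; rewrite mulrDl.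
Qed.

Lemma innerZl a f g : square_integrable f -> square_integrable g ->
  inner (fun x => a * f x) g = a * inner f g.
Proof.
move=> hf hg; rewrite -RintegralZl//; last exact: square_integrable_integrableM.
by apply: eq_Rintegral => x _ /=; rewrite mulrA.
Qed.

Lemma innerBl f g h : square_integrable f -> square_integrable g ->
  square_integrable h -> inner (f \- g) h = inner f h - inner g h.
Proof.
move=> hf hg hh; rewrite -RintegralB//; last 2 first.
  exact: square_integrable_integrableM.
  exact: square_integrable_integrableM.
by apply: eq_Rintegral => x _ /=; rewrite mulrBl.
Qed.

Lemma innerDr f g h : square_integrable f -> square_integrable g ->
  square_integrable h -> inner h (f \+ g) = inner h f + inner h g.
Proof. by move=> *; rewrite innerC innerDl// !(innerC h). Qed.

Lemma innerZr a f g : square_integrable f -> square_integrable g ->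
  inner g (fun x => a * f x) = a * inner g f.
Proof. by move=> *; rewrite innerC innerZl// innerC. Qed.

Lemma innerBr f g h : square_integrable f -> square_integrable g ->
  square_integrable h -> inner h (f \- g) = inner h f - inner h g.
Proof. by move=> *; rewrite innerC innerBl// !(innerC h). Qed.

(** Both sides agree after bilinear expansion. It reduces the inner product of two differences to
    squared norms of differences, the only quantities that the law of single increments provides. *)
Lemma inner_polarization f g h k : square_integrable f ->
  square_integrable g -> square_integrable h -> square_integrable k ->
  inner (g \- f) (k \- h) *+ 2 =
  inner (k \- f) (k \- f) + inner (g \- h) (g \- h)
  - inner (k \- g) (k \- g) - inner (h \- f) (h \- f).
Proof.
move=> hf hg hh hk; have hB := square_integrableB.
rewrite !innerBl//; try exact: hB.
rewrite !innerBr// (innerC k f) (innerC g h) (innerC k g) (innerC h f); ring.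
Qed.

(** This replaces Cauchy-Schwarz and avoids square roots. For each sign [e], the squared norm of [f]
    plus [e / a] times [g] is nonnegative; multiply it by [a] and expand. *)
Lemma inner_young a f g : 0 < a -> square_integrable f ->
  square_integrable g -> `|inner f g| <= a * inner f f + a^-1 * inner g g.
Proof.
move=> a0 hf hg.
have key e : e ^+ 2 = 1 -> - e * inner f g *+ 2 <= a * inner f f + a^-1 * inner g g.
  move=> e2; have hag := square_integrableZ (e * a^-1) hg.
  have := inner_ge0 (f \+ (fun x => (e * a^-1) * g x)).
  have hs := square_integrableD hf hag.
  rewrite innerDl// !innerDr// !innerZl// !innerZr//.
  rewrite (innerC g f) => /(mulr_ge0 (ltW a0)).
  set F := inner f f; set G := inner g g; set H := inner f g.
  have -> : a * (F + e * a^-1 * H + (e * a^-1 * H + e * a^-1 * (e * a^-1 * G)))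
     = a * F + e * H *+ 2 + e ^+ 2 * a^-1 * G by field; rewrite gt_eqF.
  by rewrite e2; lra.
have k1 := key 1 (expr1n _ _); have := key (-1) ltac:(by rewrite sqrrN expr1n).
have := mulr_ge0 (ltW a0) (inner_ge0 f).
have : 0 <= a^-1 * inner g g by rewrite mulr_ge0 ?inner_ge0// invr_ge0 ltW.
by move=> *; rewrite ler_norml; apply/andP; split; lra.
Qed.

(** Convergence to 0 makes one of the distances finite, say at index [N]; then [f] is the sum of
    [f \- f_ N] and [f_ N], both square integrable. *)
Lemma square_integrable_cvg f (f_ : nat -> T -> R) :
  measurable_fun setT f -> (forall k, square_integrable (f_ k)) ->
  (\int[m]_x ((f x - f_ k x) ^+ 2)%:E)%E @[k --> \oo] --> 0%E ->
  square_integrable f.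
Proof.
move=> mf hf_ /fine_cvgP[[N _ /(_ N (leqnn N)) /= Nfin] _].
have hfN : square_integrable (f \- f_ N).
  split; first by apply: measurable_funB => //; exact: (hf_ N).1.
  by rewrite /= ltey_eq Nfin.
rewrite (_ : f = (f \- f_ N) \+ f_ N); first exact: square_integrableD.
by apply/funext => x /=; rewrite subrK.
Qed.

(** Continuity of the inner product: the difference splits into two terms linear in one error and a
    product of both errors, each controlled by [inner_young]. *)
Lemma inner_cvg f g (f_ g_ : nat -> T -> R) :
  square_integrable f -> square_integrable g ->
  (forall k, square_integrable (f_ k)) -> (forall k, square_integrable (g_ k)) ->
  (\int[m]_x ((f x - f_ k x) ^+ 2)%:E)%E @[k --> \oo] --> 0%E ->
  (\int[m]_x ((g x - g_ k x) ^+ 2)%:E)%E @[k --> \oo] --> 0%E ->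
  inner (f_ k) (g_ k) @[k --> \oo] --> inner f g.
Proof.
move=> hf hg hf_ hg_ cf cg.
pose u h (h_ : nat -> T -> R) k := inner (h \- h_ k) (h \- h_ k).
have cvgu h (h_ : nat -> T -> R) :
    (\int[m]_x ((h x - h_ k x) ^+ 2)%:E)%E @[k --> \oo] --> 0%E ->
    u h h_ k @[k --> \oo] --> 0.
  by move=> /fine_cvgP[_].
have /cvgrPdist_lt cu := cvgu _ _ cf; have /cvgrPdist_lt cv := cvgu _ _ cg.
apply/cvgrPdist_lt => e e0.
set K := inner f f + inner g g + 1.
have K0 : 0 < K by rewrite ltr_pwDr// addr_ge0// inner_ge0.
(* This weight is used in [inner_young] for the two linear terms: the fixed functions contribute
   less than [t * K <= e / 2]. Errors below [t * (e / 8)] stay below [e / 8] after division by [t],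
   and four such terms give the other [e / 2]. *)
pose t := Num.min 1 (e / (2 * K)).
have t0 : 0 < t by rewrite lt_min ltr01 divr_gt0// mulr_gt0.
have tK : t * K <= e / 2.
  have -> : e / 2 = e / (2 * K) * K by field; rewrite gt_eqF.
  by rewrite ler_pM2r// ge_min lexx orbT.
have t1 : t <= 1 by rewrite ge_min lexx.
near=> k.
have hdf := square_integrableB hf (hf_ k).
have hdg := square_integrableB hg (hg_ k).
have -> : inner f g - inner (f_ k) (g_ k) =
    inner f (g \- g_ k) + inner (f \- f_ k) g - inner (f \- f_ k) (g \- g_ k).
  by rewrite !(innerBl, innerBr)//; ring.
have y1 := inner_young t0 hf hdg.
have y2 := inner_young t0 hg hdf.
have y3 := inner_young (@ltr01 R) hdf hdg.
have /= du : u f f_ k < t * (e / 8).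
  have : `|0 - u f f_ k| < t * (e / 8).
    by near: k; apply: cu; rewrite mulr_gt0// divr_gt0.
  by rewrite sub0r normrN; exact: le_lt_trans (ler_norm _).
have /= dv : u g g_ k < t * (e / 8).
  have : `|0 - u g g_ k| < t * (e / 8).
    by near: k; apply: cv; rewrite mulr_gt0// divr_gt0.
  by rewrite sub0r normrN; exact: le_lt_trans (ler_norm _).
rewrite -/(u g g_ k) in y1 y3; rewrite -/(u f f_ k) in y2 y3.
rewrite innerC in y2.
rewrite invr1 !mul1r in y3.
have du' : t^-1 * u f f_ k < e / 8 by rewrite mulrC ltr_pdivrMr// mulrC.
have dv' : t^-1 * u g g_ k < e / 8 by rewrite mulrC ltr_pdivrMr// mulrC.
have te : t * (e / 8) <= e / 8 by rewrite ler_piMl// divr_ge0// ltW.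
apply: le_lt_trans (ler_normB _ _) _.
apply: le_lt_trans (lerD (ler_normD _ _) (lexx _)) _.
have : t * K = t * inner f f + t * inner g g + t by rewrite /K; ring.
move: y1 y2 y3; move: (`|_|) (`|_|) (`|_|) => A B C.
lra.
Unshelve. all: by end_near. Qed.

End square_integrable.

(** * Second moment of the centred normal law *)

Section normal_second_moment.
Context {R : realType}.
Local Notation mu := (@lebesgue_measure R).

(** The Radon-Nikodym derivative of [normal_prob] and [normal_pdf] have the same integral over every
    measurable set, so they agree almost everywhere. *)
Lemma ge0_integral_normal_prob (m s : R) (f : R -> \bar R) :
  (forall x, 0 <= f x)%E -> measurable_fun setT f ->
  (\int[normal_prob m s]_x f x = \int[mu]_x (f x * (normal_pdf m s x)%:E))%E.
Proof.
move=> f0 mf; have dom := @normal_prob_dominates R m s.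
have mpdf : measurable_fun setT (fun x => (normal_pdf m s x)%:E).
  by apply/measurable_EFinP; exact: measurable_normal_pdf.
rewrite -(Radon_Nikodym_SigmaFinite.change_of_variables dom)//.
have intRN := Radon_Nikodym_SigmaFinite.f_integrable dom.
apply: ae_eq_integral => //.
- by apply: emeasurable_funM => //; exact: measurable_int intRN.
- exact: emeasurable_funM.
- apply: ae_eqe_mul2l; apply: integral_ae_eq => //.
  by move=> A _ mA; rewrite -(Radon_Nikodym_SigmaFinite.f_integral dom).
Qed.

Definition normal_second_moment (s : R) : \bar R :=
  (\int[mu]_x (x ^+ 2 * normal_pdf 0 s x)%:E)%E.

(** Substitute [x * s] for [x]; the factor [s] from the derivative turns the peak for deviation [s]
    into the standard one. This makes the variance of an increment linear in its length. *)
Lemma normal_second_moment_scale (s : R) : 0 < s ->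
  normal_second_moment s = ((s ^+ 2)%:E * normal_second_moment 1)%E.
Proof.
move=> s0; have sN0 : s != 0 by rewrite gt_eqF.
have F'E : (fun x : R^o => x * s : R^o)^`()%classic = cst s.
  apply/funext => x; rewrite derive1E deriveM// derive_cst derive_id scaler0.
  by rewrite add0r /GRing.scale/= mulr1.
rewrite /normal_second_moment.
rewrite (@increasing_ge0_integration_by_substitutionT R (fun x => x * s)
  (fun x => x ^+ 2 * normal_pdf 0 s x)).
- rewrite -ge0_integralZl ?lee_fin ?sqr_ge0//; last 2 first.
  + apply/measurable_EFinP/measurable_funM => //.
    exact: measurable_normal_pdf.
  + by move=> x _; rewrite lee_fin mulr_ge0 ?sqr_ge0 ?normal_pdf_ge0.
  apply: eq_integral => x _; rewrite F'E -EFinM; congr EFin.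
  rewrite !fctE/= !normal_pdfE// /normal_fun.
  have -> : - (x * s - 0) ^+ 2 / (s ^+ 2 *+ 2) = - (x - 0) ^+ 2 / (1 ^+ 2 *+ 2).
    by field.
  have -> : normal_peak 1 = normal_peak s * s.
    rewrite /normal_peak expr1n mul1r -mulrnAr sqrtrM ?sqr_ge0// sqrtr_sqr.
    by rewrite gtr0_norm// invfM mulrAC mulVf// mul1r.
  ring.
- by move=> x y xy; rewrite ltr_pM2r.
- by rewrite F'E => ?; exact: cvg_cst.
- by rewrite F'E; exact: is_cvg_cst.
- by rewrite F'E; exact: is_cvg_cst.
- by [].
- by apply: gt0_cvgMlNy.
- by apply: gt0_cvgMly.
- move=> x; apply: cvgM; first exact: sqr_continuous.
  exact: continuous_normal_pdf.
- by move=> x; rewrite mulr_ge0 ?sqr_ge0 ?normal_pdf_ge0.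
Qed.

(** The integrand is at most a multiple of the normal density of deviation 2, whose integral is 1.
    The exponents differ by [3 / 8 * x ^+ 2], and [1 + y <= expR y] at that value absorbs [x ^+ 2]
    at the price of [8 / 3]; [K] also carries the ratio of the two peaks. *)
Lemma normal_second_moment_lty : (normal_second_moment 1 < +oo)%E.
Proof.
pose K := 8 / 3 * normal_peak 1 / normal_peak 2 : R.
have p20 : 0 < normal_peak 2 :> R by apply: normal_peak_gt0.
have K0 : 0 <= K by rewrite !mulr_ge0 ?normal_peak_ge0// invr_ge0 ltW.
apply: (@le_lt_trans _ _ (\int[mu]_x (K%:E * (normal_pdf 0 2 x)%:E))%E).
  apply: ge0_le_integral => //.
  - by move=> x _; rewrite lee_fin mulr_ge0 ?sqr_ge0 ?normal_pdf_ge0.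
  - apply/measurable_EFinP/measurable_funM => //.
    exact: measurable_normal_pdf.
  - apply: emeasurable_funM => //; apply/measurable_EFinP.
    exact: measurable_normal_pdf.
  - move=> x _; rewrite -EFinM lee_fin !normal_pdfE// /K.
    rewrite (_ : _ * (_ * normal_fun 0 2 x) =
      normal_peak 1 * (8 / 3 * normal_fun 0 2 x)); last first.
      by field; rewrite gt_eqF.
    rewrite mulrCA ler_wpM2l ?normal_peak_ge0// /normal_fun subr0.
    have -> : - x ^+ 2 / (1 ^+ 2 *+ 2) =
        - x ^+ 2 / (2 ^+ 2 *+ 2) - 3 / 8 * x ^+ 2 by field.
    rewrite expRD [leRHS]mulrC mulrCA ler_wpM2l ?expR_ge0//.
    rewrite expRN ler_pdivrMr ?expR_gt0//.
    have := expR_ge1Dx (3 / 8 * x ^+ 2); lra.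
rewrite ge0_integralZl ?lee_fin//; last 2 first.
  by apply/measurable_EFinP; exact: measurable_normal_pdf.
  by move=> x _; rewrite lee_fin normal_pdf_ge0.
by rewrite integral_normal_pdf mule1 ltry.
Qed.

End normal_second_moment.

(** * The isometry of the Wiener integral, up to the constant [v] *)

Section wiener_isometry.
Context d (T : measurableType d) (R : realType) (P : probability T R).
Variable W : R -> {RV P >-> R}.
Hypothesis W_wiener : two_sided_wiener W.
Local Notation mu := (@lebesgue_measure R).

(* The value of this constant is 1; only its finiteness matters. *)
Let v : R := fine (@normal_second_moment R 1).

Let increment (a b : R) : T -> R := fun w => W b w - W a w.

Lemma measurable_increment a b : measurable_fun setT (increment a b).
Proof. by apply: measurable_funB. Qed.

Lemma wiener_increment_sqr a b : a < b ->
  (\int[P]_w (increment a b w ^+ 2)%:E = ((b - a) * v)%:E)%E.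
Proof.
move=> ab; have [_ _ law _] := W_wiener.
have mI := measurable_increment a b.
have msq : measurable_fun [set: R] (fun x : R => (x ^+ 2)%:E).
  by apply/measurable_EFinP; exact: measurable_funX.
have mX : measurable_fun setT (increment a b : T -> measurableTypeR R) := mI.
pose X : {mfun T >-> measurableTypeR R} :=
  HB.pack (increment a b : T -> measurableTypeR R)
    (isMeasurableFun.Build _ _ _ _ _ mX).
transitivity (\int[distribution P X]_x (x ^+ 2)%:E)%E.
  by rewrite ge0_integral_distribution// => x; rewrite lee_fin sqr_ge0.
rewrite (eq_measure_integral (normal_prob 0 (Num.sqrt (b - a)))); last first.
  by move=> A mA _; exact: law.
rewrite ge0_integral_normal_prob//; last by move=> x; rewrite lee_fin sqr_ge0.
have := @normal_second_moment_scale R (Num.sqrt (b - a)).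
rewrite sqrtr_gt0 subr_gt0 => /(_ ab).
rewrite /normal_second_moment => ->.
rewrite sqr_sqrtr ?subr_ge0 ?ltW// EFinM /v fineK//.
rewrite ge0_fin_numE ?normal_second_moment_lty//.
by apply: integral_ge0 => x _; rewrite lee_fin mulr_ge0 ?sqr_ge0 ?normal_pdf_ge0.
Qed.

(** The times come in either order because polarization compares four unordered times; a backward
    increment is the opposite of a forward one. *)
Lemma inner_increment_sqr a b :
  square_integrable P (increment a b) /\
  inner P (increment a b) (increment a b) = `|b - a| * v.
Proof.
have key a' b' : a' < b' -> square_integrable P (increment a' b') /\
    inner P (increment a' b') (increment a' b') = (b' - a') * v.
  move=> ab; split.
    by split; [exact: measurable_increment|rewrite wiener_increment_sqr// ltry].
  rewrite /inner /Rintegral; under eq_integral do rewrite -expr2.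
  by rewrite wiener_increment_sqr.
have [ab|ba|->] := ltgtP a b.
- by rewrite gtr0_norm ?subr_gt0//; exact: key.
- have [h1 h2] := key _ _ ba.
  have -> : increment a b = fun w => -1 * increment b a w.
    by apply/funext => w; rewrite /increment; ring.
  split; first exact: square_integrableZ.
  rewrite innerZl// ?innerZr//; last exact: square_integrableZ.
  by rewrite h2 ltr0_norm ?subr_lt0//; ring.
- have -> : increment b b = fun=> 0 by apply/funext => w; rewrite /increment subrr.
  split; first exact: square_integrable0.
  by rewrite subrr normr0 mul0r inner0l.
Qed.

Lemma square_integrable_increment a b : square_integrable P (increment a b).
Proof. exact: (inner_increment_sqr a b).1. Qed.

(* Polarization reduces covariances to variances of single increments. *)
Lemma inner_increment a b c e :
  inner P (increment a b) (increment c e) =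
  (`|e - a| + `|b - c| - `|e - b| - `|c - a|) / 2 * v.
Proof.
have si := square_integrable_increment.
have split_inc x y : increment x y = increment 0 y \- increment 0 x.
  by apply/funext => w; rewrite /increment/=; ring.
(* Increments from time 0 replace the values of [W], since square integrability has been established
   for increments. *)
have := inner_polarization (si 0 a) (si 0 b) (si 0 c) (si 0 e).
rewrite -!split_inc !(inner_increment_sqr _ _).2 => h.
by apply: (@mulIf _ 2) => //; rewrite mulr_natr h; field.
Qed.

Let box (a b : R) : R -> R := \1_(`]a, b] : set R).

Lemma square_integrable_indic_itv a b : square_integrable mu (box a b).
Proof.
split; first exact: measurable_indic.
have -> : (fun x => (box a b x ^+ 2)%:E) = (fun x => (\1_(`]a, b] : set R) x)%:E).
  by apply/funext => x; rewrite /box indicE; case: (_ \in _);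
    rewrite ?expr1n ?expr0n.
rewrite integral_indic//= setIT lebesgue_measure_itv/=.
by case: ifP => _; rewrite ?ltry// -EFinD ltry.
Qed.

(** The overlap of the two intervals runs from the larger left end to the smaller right end. Its
    length is put in the form found in [inner_increment], so that the two formulas match up to
    [v]. *)
Lemma inner_indic_itv a b c e : a <= b -> c <= e ->
  inner mu (box a b) (box c e) =
  (`|e - a| + `|b - c| - `|e - b| - `|c - a|) / 2.
Proof.
move=> ab ce; rewrite /inner /Rintegral.
have -> : (fun x => (box a b x * box c e x)%:E) =
    (fun x => (\1_(`](Num.max a c), (Num.min b e)] : set R) x)%:E).
  apply/funext => x; congr EFin; rewrite /box -[LHS]/((\1_`]a, b] \* \1_`]c, e]) x).
  rewrite -indicI; congr (\1_ _ x); apply/seteqP.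
  split => y /=; rewrite !in_itv/= gt_max le_min.
    by move=> [/andP[-> ->] /andP[-> ->]].
  by move=> /andP[/andP[-> ->] /andP[-> ->]].
rewrite integral_indic//= setIT lebesgue_measure_itv/= lte_fin.
have eqmax x y : Num.max x y = (x + y + `|y - x|) / 2 :> R.
  have [xy|yx] := leP x y; first by rewrite ger0_norm ?subr_ge0//; lra.
  by rewrite ltr0_norm ?subr_lt0//; lra.
have eqmin x y : Num.min x y = (x + y - `|y - x|) / 2 :> R.
  have [xy|yx] := leP x y; first by rewrite ger0_norm ?subr_ge0//; lra.
  by rewrite ltr0_norm ?subr_lt0//; lra.
have nE (x y : R) : (x <= y /\ `|y - x| = y - x) \/ (y < x /\ `|y - x| = x - y).
  have [xy|yx] := leP x y; [left|right]; split => //.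
    by rewrite ger0_norm ?subr_ge0.
  by rewrite ltr0_norm ?subr_lt0// opprB.
rewrite -EFinD [fine _](_ : _ = if Num.max a c < Num.min b e
   then Num.min b e - Num.max a c else 0); last by case: ifP.
rewrite eqmax eqmin.
(* The order within these four pairs resolves every absolute value; the last case split tells
   whether the overlap is empty. Each case is then linear. *)
have [[h1 ->]|[h1 ->]] := nE a e; have [[h2 ->]|[h2 ->]] := nE c b;
have [[h3 ->]|[h3 ->]] := nE b e; have [[h4 ->]|[h4 ->]] := nE a c;
case: ltP => h; lra.
Qed.

Lemma step_fun_nil : step_fun [::] = (fun=> 0) :> (R -> R).
Proof. by apply/funext => u; rewrite /step_fun big_nil. Qed.

Lemma step_fun_cons e s :
  step_fun (e :: s) = (fun u => e.1 * box e.2.1 e.2.2 u) \+ step_fun s.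
Proof. by apply/funext => u; rewrite /step_fun big_cons. Qed.

Lemma step_integral_nil : step_integral W [::] = fun=> 0.
Proof. by apply/funext => u; rewrite /step_integral big_nil. Qed.

Lemma step_integral_cons e s : step_integral W (e :: s) =
  (fun u => e.1 * increment e.2.1 e.2.2 u) \+ step_integral W s.
Proof. by apply/funext => u; rewrite /step_integral big_cons. Qed.

Lemma square_integrable_step_fun s : square_integrable mu (step_fun s).
Proof.
elim: s => [|e s ih]; first by rewrite step_fun_nil; exact: square_integrable0.
rewrite step_fun_cons; apply: square_integrableD => //.
exact/square_integrableZ/square_integrable_indic_itv.
Qed.

Lemma square_integrable_step_integral s :
  square_integrable P (step_integral W s).
Proof.
elim: s => [|e s ih].
  by rewrite step_integral_nil; exact: square_integrable0.
rewrite step_integral_cons; apply: square_integrableD => //.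
exact/square_integrableZ/square_integrable_increment.
Qed.

(** By bilinearity and induction on both lists, it suffices to compare one increment pair with one
    indicator pair. The intervals of a list may overlap, since the two formulas cover every pair of
    intervals with ordered ends. *)
Lemma step_integral_isometry s s' : step_data_wf s -> step_data_wf s' ->
  inner P (step_integral W s) (step_integral W s') =
  v * inner mu (step_fun s) (step_fun s').
Proof.
have si := square_integrable_increment.
have sb := square_integrable_indic_itv.
have sI := square_integrable_step_integral.
have sF := square_integrable_step_fun.
move=> ws ws'; elim: s ws => [|e s ih] ws; 
  first by rewrite step_integral_nil step_fun_nil !inner0l mulr0.
have wfe : e.2.1 <= e.2.2 by apply: ws; rewrite mem_head.
have {}ih := ih (fun x xs => ws x (mem_behead (s := e :: s) xs)).
rewrite step_integral_cons step_fun_cons.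
rewrite !innerDl//; try exact: square_integrableZ.
rewrite !innerZl// ih mulrDr; congr (_ + _); rewrite mulrCA; congr (_ * _).
elim: s' ws' {ih} => [|e' s' ih] ws'.
  by rewrite step_integral_nil step_fun_nil !(innerC _ _ (fun=> 0)) !inner0l mulr0.
have wfe' : e'.2.1 <= e'.2.2 by apply: ws'; rewrite mem_head.
have {}ih := ih (fun x xs => ws' x (mem_behead (s := e' :: s') xs)).
rewrite step_integral_cons step_fun_cons !innerDr//; try exact: square_integrableZ.
rewrite !innerZr// ih mulrDr; congr (_ + _); rewrite mulrCA; congr (_ * _).
by rewrite inner_increment inner_indic_itv// mulrC.
Qed.

(** The isometry for step functions passes to the limit on both sides by [inner_cvg], and limits are
    unique. *)
Lemma wiener_integral_isometry (f g : R -> R) (I J : {RV P >-> R}) :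
  is_wiener_integral W f I -> is_wiener_integral W g J ->
  [/\ square_integrable P I, square_integrable P J,
      square_integrable mu f, square_integrable mu g &
      inner P I J = v * inner mu f g].
Proof.
move=> [mf [s [ws fs Is]]] [mg [s' [ws' gs Js]]].
rewrite unlock in Is Js.
have sI := square_integrable_step_integral.
have sF := square_integrable_step_fun.
have hf : square_integrable mu f by exact: square_integrable_cvg fs.
have hg : square_integrable mu g by exact: square_integrable_cvg gs.
have hI : square_integrable P I by exact: square_integrable_cvg Is.
have hJ : square_integrable P J by exact: square_integrable_cvg Js.
split => //.
have cP := inner_cvg hI hJ (fun k => sI (s k)) (fun k => sI (s' k)) Is Js.
have cmu := inner_cvg hf hg (fun k => sF (s k)) (fun k => sF (s' k)) fs gs.
have cv : v * inner mu (step_fun (s k)) (step_fun (s' k)) @[k --> \oo] -->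
    v * inner mu f g by apply: cvgM => //; exact: cvg_cst.
rewrite -(cvg_lim _ cP)// -(cvg_lim _ cv)//; congr (limn _).
by apply/funext => k; exact: step_integral_isometry.
Qed.

End wiener_isometry.

(** * Invariance of Lebesgue measure under reflections *)

Section reflection.
Context {R : realType}.
Local Notation mu := (@lebesgue_measure R).

(** The image of Lebesgue measure under the reflection agrees with it on half-open intervals, hence
    is equal to it by uniqueness. *)
Lemma ge0_integral_reflect (a : R) (f : R -> \bar R) :
  measurable_fun setT f -> (forall x, 0 <= f x)%E ->
  (\int[mu]_x f (a - x)%R = \int[mu]_x f x)%E.
Proof.
move=> mf f0.
pose phi : measurableTypeR R -> measurableTypeR R := fun x => a - x.
have mphi : measurable_fun setT phi.
  have : measurable_fun [set: R] (fun x : R => a - x) by exact: measurable_funB.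
  by [].
pose X : {mfun measurableTypeR R >-> measurableTypeR R} :=
  HB.pack phi (isMeasurableFun.Build _ _ _ _ _ mphi).
transitivity (\int[pushforward mu X]_x f x)%E.
  by rewrite ge0_integral_pushforward.
apply/esym/eq_measure_integral => A mA _.
apply: lebesgue_measure_unique mA => _ [[x y]] _ <-.
transitivity (mu (phi @^-1` `]x, y]%classic)); last by [].
rewrite (_ : phi @^-1` _ = `[a - y, a - x[%classic).
  rewrite !lebesgue_measure_itv/= !lte_fin ltrD2l ltrN2; case: ifP => // _.
  by rewrite -!EFinD; congr EFin; ring.
apply/seteqP; split => z /=; rewrite !in_itv/= /phi => /andP[h1 h2];
  apply/andP; split; lra.
Qed.

End reflection.

(** * Finiteness and monotonicity of the tail of a Lévy density *)

Section levy_tail.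
Context {R : realType}.
Local Notation mu := (@lebesgue_measure R).
Variable m : R -> R.
Hypothesis m_levy : levy_density m.

(** Beyond [x] the weight [Num.min s 1] is at least [Num.min x 1], so dividing by this constant
    bounds [m] by the integrand of the Lévy condition. Hence the real integral in [levy_tail] is a
    true value and not a default. *)
Lemma levy_density_integrable (x : R) : 0 < x ->
  mu.-integrable `]x, +oo[ (EFin \o m).
Proof.
move=> x0; have [mm m0 mfin] := m_levy.
have sub : `]x, +oo[%classic `<=` (`]0, +oo[ : set R).
  by move=> s /=; rewrite !in_itv/= !andbT; exact: lt_trans.
have mm' : measurable_fun (`]x, +oo[ : set R) m.
  by apply: measurable_funS mm => //; exact: measurable_itv.
apply/integrableP; split; first exact/measurable_EFinP.
pose c := Num.min x 1.
have c0 : 0 < c by rewrite lt_min x0 ltr01.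
have mmin : measurable_fun (`]0, +oo[ : set R) (fun s => Num.min s 1 * m s).
  by apply: measurable_funM => //; exact: measurable_minr.
apply: (@le_lt_trans _ _
  (\int[mu]_(s in `]x, +oo[) ((c^-1)%:E * (Num.min s 1 * m s)%:E))%E).
  apply: ge0_le_integral => //.
  - by apply: measurableT_comp => //; exact/measurable_EFinP.
  - apply: emeasurable_funM => //; apply/measurable_EFinP.
    exact: measurable_funS mmin.
  - move=> s xs; have s0 := sub _ xs.
    move: xs s0; rewrite /= !in_itv/= !andbT => xs s0.
    rewrite lee_fin ger0_norm ?m0// mulrA ler_peMl ?m0//.
    by rewrite mulrC ler_pdivlMr// mul1r le_min !ge_min lexx orbT (ltW xs).
rewrite ge0_integralZl//; last 3 first.
- by apply/measurable_EFinP; exact: measurable_funS mmin.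
- move=> s /sub /=; rewrite in_itv/= andbT => s0.
  by rewrite lee_fin mulr_ge0 ?m0// le_min ltW//=.
- by rewrite lee_fin invr_ge0 ltW.
rewrite lte_mul_pinfty// ?lee_fin ?invr_ge0 ?ltW//.
apply: le_lt_trans mfin; apply: ge0_subset_integral => //.
- exact/measurable_EFinP.
- move=> s /=; rewrite in_itv/= andbT => s0.
  by rewrite lee_fin mulr_ge0 ?m0// le_min ltW//=.
Qed.

Lemma levy_tail_ge0 (x : R) : 0 <= levy_tail m x.
Proof.
rewrite /levy_tail; case: ltP => // x0; apply: Rintegral_ge0 => z /=.
have [_ m0 _] := m_levy.
by rewrite in_itv/= andbT => xz; exact/m0/(lt_trans x0).
Qed.

Lemma levy_tail_nonincreasing (x y : R) : 0 < x -> x <= y ->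
  levy_tail m y <= levy_tail m x.
Proof.
move=> x0 xy; have y0 := lt_le_trans x0 xy; rewrite /levy_tail x0 y0.
rewrite fine_le ?integrable_fin_num//; try exact: levy_density_integrable.
have [_ m0 _] := m_levy.
apply: ge0_subset_integral => //.
- by apply: measurable_int; exact: levy_density_integrable.
- move=> z /=; rewrite in_itv/= andbT => xz.
  by rewrite lee_fin m0// (lt_trans x0).
- by move=> z /=; rewrite !in_itv/= !andbT; exact: le_lt_trans.
Qed.

End levy_tail.

(** * An integrable bound for the summed kernel products *)

Section kernel_summability.
Context {R : realType}.
Local Notation mu := (@lebesgue_measure R).
Variable nu : R -> R.
Hypothesis nu_npos : forall x : R, x <= 0 -> nu x = 0.
Hypothesis nu_ge0 : forall x, 0 <= nu x.
Hypothesis nu_noninc : forall x y : R, 0 < x -> x <= y -> nu y <= nu x.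
Hypothesis nu_L2 : in_Lp 2 `]0, 1[ nu.

Lemma B_kernelSB n (u : R) :
  B_kernel nu n.+1%:R u - B_kernel nu n%:R u =
  nu (Num.max (n.+1%:R - u) 0) - nu (Num.max (n%:R - u) 0).
Proof. by rewrite /B_kernel; ring. Qed.

Lemma B_kernel1_eq0 (u : R) : 1 <= u -> B_kernel nu 1 u = 0.
Proof. by move=> u1; rewrite /B_kernel !max_r ?subrr//; lra. Qed.

Lemma sum_B_kernel_increments_le N (u : R) : u < 1 ->
  \sum_(1 <= n < N) `|B_kernel nu n.+1%:R u - B_kernel nu n%:R u| <= nu (1 - u).
Proof.
move=> u1; have [N0|N0] := leqP N 1; first by rewrite big_geq.
(* All arguments are positive, so the truncation disappears and monotonicity gives every increment
   the same sign. *)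
have pos n : (1 <= n)%N -> 0 < n%:R - u.
  by move=> n1; rewrite subr_gt0 (lt_le_trans u1)// ler1n.
have -> : \sum_(1 <= n < N) `|B_kernel nu n.+1%:R u - B_kernel nu n%:R u| =
    - \sum_(1 <= n < N) (nu (n.+1%:R - u) - nu (n%:R - u)).
  rewrite -sumrN; apply: eq_big_nat => n /andP[n1 _].
  rewrite B_kernelSB !max_l ?ltW ?pos// ler0_norm// subr_le0.
  by rewrite nu_noninc ?pos// lerD2r ler_nat.
rewrite (telescope_sumr (fun n => nu (n%:R - u)))//; last exact: ltnW.
by rewrite opprB lerBlDr lerDl.
Qed.

(* Monotonicity bounds |B_kernel nu 1| by c j on [-(j + 2), -(j + 1)]. *)
Let c (j : nat) : R := nu j.+1%:R - nu j.+3%:R.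

Let c_ge0 j : 0 <= c j.
Proof. by rewrite subr_ge0 nu_noninc// ?ltr0n// ler_nat leqW. Qed.

Let sum_c_le N : \sum_(0 <= j < N) c j <= nu 1 + nu 2.
Proof.
(* The arguments in [c] differ by two, so telescoping leaves two terms at each end. *)
have -> : \sum_(0 <= j < N) c j = nu 1 + nu 2 - nu N.+1%:R - nu N.+2%:R.
  elim: N => [|N ih]; first by rewrite big_geq//; ring.
  by rewrite big_nat_recr//= ih /c; ring.
by have := nu_ge0 N.+1%:R; have := nu_ge0 N.+2%:R; lra.
Qed.

(** A staircase above the kernel on [u < -1]. Its steps have length 1, so its integral is the
    telescoping sum of the [c j]. Neighbouring closed steps share an endpoint, which is harmless for
    an upper bound. *)
Let tail (u : R) : \bar R :=
  (\sum_(j <oo) (c j * \1_(`[- j.+2%:R, - j.+1%:R] : set R) u)%:E)%E.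

Let tail_term_ge0 j u : (0 <= (c j * \1_(`[- j.+2%:R, - j.+1%:R] : set R) u)%:E)%E.
Proof. by rewrite lee_fin mulr_ge0// indicE. Qed.

Let tail_ge0 u : (0 <= tail u)%E.
Proof. exact: nneseries_ge0. Qed.

Let measurable_tail_term j :
  measurable_fun setT (fun u => (c j * \1_(`[- j.+2%:R, - j.+1%:R] : set R) u)%:E).
Proof. by apply/measurable_EFinP/measurable_funM. Qed.

Let measurable_tail : measurable_fun setT tail.
Proof. exact: ge0_emeasurable_sum. Qed.

Let tail_lty : (\int[mu]_u tail u < +oo)%E.
Proof.
rewrite integral_nneseries//.
apply: (@le_lt_trans _ _ (nu 1 + nu 2)%:E); last exact: ltry.
apply: lime_le.
  by apply: is_cvg_nneseries => j _ _; exact: integral_ge0.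
near=> N; apply: le_trans (_ : (\sum_(0 <= j < N) c j)%:E <= _)%E; last first.
  by rewrite lee_fin.
rewrite -sumEFin; apply: lee_sum => j _.
under eq_integral do rewrite EFinM.
rewrite ge0_integralZl ?lee_fin//; last by apply/measurable_EFinP.
rewrite integral_indic//= setIT lebesgue_measure_itv/= lte_fin ltrN2 ltr_nat ltnSn.
by rewrite -EFinD -EFinM lee_fin opprK [_ + _](_ : _ = 1) ?mulr1// -natr1; ring.
Unshelve. all: by end_near. Qed.

Let B_kernel1_le_tail (u : R) : u < -1 -> (`|B_kernel nu 1 u|%:E <= tail u)%E.
Proof.
move=> u1.
have u0 : 0 <= - u by lra.
(* The integer part [t] of [- u] is at least 1 and [u] lies in step [j = t - 1]; keeping only that
   term of the series bounds [tail u] from below. *)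
have := truncn_itv u0; set t := truncn (- u) => /andP[tl tu].
have t1 : (1 <= t)%N by rewrite -ltnS -(ltr_nat R); lra.
pose j := t.-1; have tj : t = j.+1 by rewrite /j prednK.
rewrite tj in tl tu.
apply: le_trans (nneseries_lim_ge j.+1 _); last by move=> *; exact: tail_term_ge0.
rewrite big_nat_recr//=; apply: le_trans (leeDr _ _); last exact: sume_ge0.
rewrite lee_fin indicE mem_set/=; last first.
  by rewrite in_itv/=; apply/andP; split; lra.
rewrite mulr1 /B_kernel !max_l//; try lra.
have h1 : nu (- u) <= nu j.+1%:R by apply: nu_noninc => //; rewrite ltr0n.
have h2 : nu j.+3%:R <= nu (1 - u).
  apply: nu_noninc; first lra.
  by rewrite -(natr1 j.+2) addrC lerD2r ltW.
have h3 : nu (1 - u) <= nu (- u) by apply: nu_noninc; lra.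
by rewrite ler0_norm ?subr_le0// opprB /c; lra.
Qed.

(** An integrable bound for [nu ^+ 2] on []0, 1]]. The second term covers the endpoint 1, which is
    reached at [u = 0] and [u = -1] and lies outside the interval of [nu_L2]. *)
Let k (x : R) : R := (nu \_ `]0, 1[ x) ^+ 2 + nu 1 ^+ 2 * \1_(`[0, 1] : set R) x.

Let k_ge0 x : 0 <= k x.
Proof. by rewrite addr_ge0 ?sqr_ge0// mulr_ge0 ?sqr_ge0. Qed.

Let measurable_k : measurable_fun setT (EFin \o k).
Proof.
apply/measurable_EFinP/measurable_funD; last exact: measurable_funM.
by apply: measurable_funX; move: nu_L2 => /andP[]; rewrite inE.
Qed.

Let measurable_k_reflect (a : R) :
  measurable_fun setT (fun u : R => (k (a - u))%:E).
Proof. by apply: (measurableT_comp measurable_k); exact: measurable_funB. Qed.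

Let k_lty : (\int[mu]_x (k x)%:E < +oo)%E.
Proof.
have /integrableP[mnu inu] := Lfun2_integrable_sqr nu_L2.
under eq_integral do rewrite EFinD.
rewrite ge0_integralD//; last 3 first.
- by move=> x _; rewrite lee_fin sqr_ge0.
- by move=> x _; rewrite lee_fin mulr_ge0 ?sqr_ge0.
- exact/measurable_EFinP/measurable_funM.
apply: lte_add_pinfty.
  apply: le_lt_trans inu; rewrite le_eqVlt; apply/orP; left; apply/eqP.
  by apply: eq_integral => x _; rewrite /= ger0_norm ?sqr_ge0.
under eq_integral do rewrite EFinM.
rewrite ge0_integralZl ?lee_fin ?sqr_ge0//; last by apply/measurable_EFinP.
rewrite integral_indic//= setIT lebesgue_measure_itv/= lte_fin ltr01.
by rewrite -EFinD -EFinM ltry.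
Qed.

Let le_k (x : R) : 0 < x -> x <= 1 -> nu x ^+ 2 <= k x.
Proof.
move=> x0; rewrite le_eqVlt => /predU1P[->|x1]; rewrite /k.
  rewrite indicE mem_set/= ?in_itv/= ?ler01 ?lexx// mulr1.
  by rewrite lerDr sqr_ge0.
by rewrite patchE mem_set/= ?in_itv/= ?x0 ?x1// lerDl mulr_ge0 ?sqr_ge0.
Qed.

(** The three terms serve [0 <= u < 1], [-1 <= u < 0] and [u < -1] respectively. Writing [0 - u]
    makes both uses of [k] instances of one reflection. *)
Let H (u : R) : \bar R := ((k (1 - u))%:E + (k (0 - u))%:E + (nu 1)%:E * tail u)%E.

Let kernel_le_H u :
  ((`|B_kernel nu 1 u| * nu (Num.max (1 - u) 0))%:E <= H u)%E.
Proof.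
have H0 : (0 <= (nu 1)%:E * tail u)%E by rewrite mule_ge0// lee_fin.
rewrite /H; have [u1|u1] := leP 1 u.
  by rewrite B_kernel1_eq0// normr0 mul0r !adde_ge0 ?lee_fin.
rewrite max_l; last lra.
have [u0|u0] := leP 0 u.
  rewrite -addeA; apply: le_trans (leeDl _ _); last first.
    by rewrite adde_ge0// lee_fin.
  rewrite lee_fin {1}/B_kernel max_l; last lra.
  rewrite max_r; last lra.
  by rewrite (@nu_npos 0)// subr0 ger0_norm// -expr2 le_k//; lra.
have [u2|u2] := leP (-1) u.
  rewrite -addeA addeCA; apply: le_trans (leeDl _ _); last first.
    by rewrite adde_ge0// lee_fin.
  have h1 : nu (1 - u) <= nu (- u) by apply: nu_noninc; lra.
  have h2 : nu (- u) ^+ 2 <= k (- u) by apply: le_k; lra.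
  rewrite sub0r lee_fin {1}/B_kernel !max_l; try lra.
  rewrite ler0_norm ?subr_le0// opprB; have := nu_ge0 (1 - u).
  (* With [x = nu (- u)] and [y = nu (1 - u)], where [0 <= y <= x], this is
     [(x - y) * y <= x ^+ 2]. *)
  by move: h1 h2; nra.
apply: le_trans (leeDr _ _); last by rewrite adde_ge0// lee_fin.
have h1 : nu (1 - u) <= nu 1 by apply: nu_noninc; lra.
apply: le_trans (_ : (nu 1 * `|B_kernel nu 1 u|)%:E <= _)%E.
  by rewrite lee_fin mulrC ler_wpM2r.
by rewrite EFinM lee_wpmul2l ?lee_fin// B_kernel1_le_tail.
Qed.

Let measurable_H : measurable_fun setT H.
Proof.
apply: emeasurable_funD; last exact: emeasurable_funM.
by apply: emeasurable_funD; exact: measurable_k_reflect.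
Qed.

Let H_lty : (\int[mu]_u H u < +oo)%E.
Proof.
have rlty a : (\int[mu]_u (k (a - u))%:E < +oo)%E.
  by rewrite (@ge0_integral_reflect R a (EFin \o k)).
have mk : measurable_fun [set: R] (fun u => (k (1 - u))%:E + (k (0 - u))%:E)%E.
  by apply: emeasurable_funD; exact: measurable_k_reflect.
have mt : measurable_fun [set: R] (fun u => (nu 1)%:E * tail u)%E.
  exact: emeasurable_funM.
rewrite ge0_integralD//; last 2 first.
- by move=> x _; rewrite adde_ge0// lee_fin.
- by move=> x _; rewrite mule_ge0// lee_fin.
rewrite ge0_integralD//; last 4 first.
- by move=> x _; rewrite lee_fin.
- exact: (measurable_k_reflect 1).
- by move=> x _; rewrite lee_fin.
- exact: (measurable_k_reflect 0).
rewrite ge0_integralZl ?lee_fin//; apply: lte_add_pinfty.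
  by apply: lte_add_pinfty; exact: rlty.
by rewrite lte_mul_pinfty// lee_fin.
Qed.

(** The finite sum moves inside the integral, where the telescoping bound and [kernel_le_H] dominate
    it by [H]; the integral of [H] is a bound uniform in [N]. *)
Lemma B_kernel_correlations_summable :
  (forall t, 0 <= t -> measurable_fun setT (B_kernel nu t)) ->
  exists K : R, forall N,
  (\sum_(1 <= n < N) \int[mu]_u
     (`|B_kernel nu 1 u * (B_kernel nu n.+1%:R u - B_kernel nu n%:R u)|)%:E
   <= K%:E)%E.
Proof.
move=> mB; exists (fine (\int[mu]_u H u)%E) => N.
have H0 u : (0 <= H u)%E.
  by apply: le_trans (kernel_le_H u); rewrite lee_fin mulr_ge0.
rewrite fineK ?ge0_fin_numE ?integral_ge0//.
have mF n : measurable_fun setT (fun u => (`|B_kernel nu 1 u *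
    (B_kernel nu n.+1%:R u - B_kernel nu n%:R u)|)%:E).
  apply/measurable_EFinP/measurableT_comp => //.
  by apply: measurable_funM; [exact: mB|apply: measurable_funB; exact: mB].
rewrite -ge0_integral_sum//.
apply: ge0_le_integral => //.
- by move=> u _; apply: sume_ge0 => n _; rewrite lee_fin.
- exact: emeasurable_sum.
move=> u _; apply: le_trans (kernel_le_H u).
rewrite sumEFin lee_fin; under eq_bigr do rewrite normrM.
rewrite -mulr_sumr; have [u1|u1] := leP 1 u.
  by rewrite B_kernel1_eq0// normr0 !mul0r.
rewrite ler_wpM2l// max_l; last lra.
exact: sum_B_kernel_increments_le.
Qed.

End kernel_summability.

(** * From correlations of the process to kernel integrals *)

Section correlation.
Context d (T : measurableType d) (R : realType) (P : probability T R).
Local Notation mu := (@lebesgue_measure R).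
Variables (nu : R -> R) (W B : R -> {RV P >-> R}).
Hypothesis W_wiener : two_sided_wiener W.
Hypothesis B_def : is_B_process nu W B.

Lemma measurable_B_kernel t : 0 <= t -> measurable_fun setT (B_kernel nu t).
Proof. by move=> /B_def[I [[]]]. Qed.

(** Almost surely each value of [B] is [c] times a Wiener integral, so [rho] gains [c ^+ 2] from its
    two factors and [v] from the isometry. The absolute value then goes under the integral. *)
Lemma abse_rho_le : exists2 C : R, 0 <= C & forall n,
  (`|rho B n| <= C%:E * \int[mu]_u
     (`|B_kernel nu 1 u * (B_kernel nu n.+1%:R u - B_kernel nu n%:R u)|)%:E)%E.
Proof.
pose c := Num.sqrt (B_const nu).
pose v : R := fine (@normal_second_moment R 1).
exists `|c ^+ 2 * v| => // n.
have [I1 [wI1 aeI1]] := B_def (@ler01 R).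
have [I2 [wI2 aeI2]] := B_def (ler0n R n.+1).
have [I3 [wI3 aeI3]] := B_def (ler0n R n).
have [hI1 hI2 hg1 hg2 e12] := wiener_integral_isometry W_wiener wI1 wI2.
have [_ hI3 _ hg3 e13] := wiener_integral_isometry W_wiener wI1 wI3.
have -> : rho B n =
    (c ^+ 2 * v * inner mu (B_kernel nu 1) (B_kernel nu n.+1%:R \- B_kernel nu n%:R))%:E.
  rewrite innerBr// -mulrA mulrBr -e12 -e13 -innerBr//.
  have hI23 := square_integrableB hI2 hI3.
  rewrite -(innerZl _ hI1 hI23) -innerE//; last exact: square_integrableZ.
  rewrite /rho unlock; apply: ae_eq_integral => //.
  - apply/measurable_EFinP/measurable_funM => //.
    exact: measurable_funB.
  - apply/measurable_EFinP/measurable_funM => //.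
    exact: measurable_funM.
  - apply: filterS3 aeI1 aeI2 aeI3 => w -> -> -> _ /=.
    by congr EFin; rewrite -/c; ring.
have hg23 := square_integrableB hg2 hg3.
rewrite abse_EFin normrM EFinM lee_wpmul2l//.
rewrite EFin_normr_Rintegral//; last exact: square_integrable_integrableM.
apply: le_abse_integral => //; apply/measurable_EFinP.
by apply: measurable_funM; [exact: hg1.1|exact: hg23.1].
Qed.

End correlation.

Theorem theorem5p1 (R : realType) (phi nubar nu : R -> R) (p : R)
    (phi_cbf : complete_bernstein phi)
    (nubar_levy : levy_density nubar)
    (nubar_cm : completely_monotone nubar)
    (phiE : forall x : R, 0 < x -> (phi x)%:E = laplace_exponent nubar x)
    (phi_0 : phi x @[x --> 0^'+] --> (0 : R))
    (phi_oo : phi x @[x --> +oo] --> +oo)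
    (nuE : nu = levy_tail nubar)
    (nubar_L2 : in_Lp 2 `]1, +oo[ nubar)
    (nu_L2 : in_Lp 2 `]0, 1[ nu)
    (p_ge1 : 1 <= p)
    (nu_Lp : in_Lp p `]1, +oo[ nu)
    (d : measure_display) (T : measurableType d) (P : probability T R)
    (W B : R -> {RV P >-> R})
    (W_wiener : two_sided_wiener W)
    (B_def : is_B_process nu W B) :
  short_range_dependent B.
Proof.
have nu_npos x : x <= 0 -> nu x = 0.
  by move=> x0; rewrite nuE /levy_tail ltNge x0.
have nu_ge0 x : 0 <= nu x by rewrite nuE levy_tail_ge0.
have nu_noninc x y : 0 < x -> x <= y -> nu y <= nu x.
  by rewrite nuE; exact: levy_tail_nonincreasing.
have [K HK] := B_kernel_correlations_summable nu_npos nu_ge0 nu_noninc nu_L2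
  (measurable_B_kernel B_def).
have [C C0 HC] := abse_rho_le W_wiener B_def.
apply: (@le_lt_trans _ _ (C%:E * K%:E)%E); last by rewrite -EFinM ltry.
(* The terms are nonnegative, so it is enough to bound all partial sums by [C * K]. *)
apply: lime_le; first exact: is_cvg_nneseries.
near=> N; apply: (@le_trans _ _ (\sum_(1 <= n < N) (C%:E * \int[lebesgue_measure]_u
  (`|B_kernel nu 1 u * (B_kernel nu n.+1%:R u - B_kernel nu n%:R u)|)%:E))%E).
  exact: lee_sum.
rewrite -ge0_sume_distrr; last by move=> n _; exact: integral_ge0.
by rewrite lee_wpmul2l.
Unshelve. all: by end_near. Qed.
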